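(* Let $n\ge2$ and let $\{x_1,\dots,x_n\}$ be a linearly independent system of vectors in $H$. Then $$\Gamma(x_1,\dots,x_n)\le\|x_1\|^2\prod_{k=2}^n\left[\|x_k\|^2-\frac{\sum_{i=1}^{k-1}|\langle x_k,x_i\rangle|^2}{\max_{1\le i\le k-1}\left[\sum_{j=1}^{k-1}|\langle x_i,x_j\rangle|\right]}\right]\le\prod_{j=1}^n\|x_j\|^2.$$
   Context: $(H;\langle\cdot,\cdot\rangle)$ is an inner product space over the real or complex number field, with norm $\|x\|=\langle x,x\rangle^{1/2}$. For vectors $y_1,\dots,y_m\in H$, $\Gamma(y_1,\dots,y_m)$ denotes the Gram determinant, i.e. the determinant of the $m\times m$ matrix whose $(i,j)$-entry is $\langle y_i,y_j\rangle$. *)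

(* Defs.v *)
From HB Require Import structures.
From mathcomp Require Import all_boot all_order all_algebra.
From mathcomp Require Import reals.
From mathcomp.real_closed Require Import complex.

Set Implicit Arguments.
Unset Strict Implicit.
Unset Printing Implicit Defensive.

Import Order.TTheory GRing.Theory Num.Theory.

Local Open Scope ring_scope.

(* [free] of vector.v is only available in finite-dimensional spaces; this is
   the right-hand side of its characterization [freeP], for any module. *)
Definition lin_indep (K : nzRingType) (H : lmodType K) (n : nat)
    (x : n.-tuple H) : Prop :=
  forall c : 'I_n -> K, \sum_(i < n) c i *: x`_i = 0 -> forall i, c i = 0.

Definition gram (K : comNzRingType) (H : lmodType K) (dot : H -> H -> K)
    (m : nat) (y : m.-tuple H) : K :=
  \det (\matrix_(i < m, j < m) dot y`_i y`_j).

(* Inner products are the positive definite Hermitian forms [{dot H for theta}],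
   with theta the identity over R and the conjugation over R[i]; they are linear
   in the first argument and theta-linear in the second. *)
Definition norm_real (R : realType) (H : lmodType R)
    (dot : {dot H for (@idfun R)}) (x : H) : R :=
  Num.sqrt (dot x x).

(* Norms and moduli over R[i] are nonnegative reals seen as elements of R[i].
   In R[i], [z <= w] means that w - z is a nonnegative real, so an inequality
   whose right-hand side is real also asserts that its left-hand side is real. *)
Definition norm_complex (R : realType) (H : lmodType R[i])
    (dot : {dot H for (@Num.conj R[i])}) (x : H) : R[i] :=
  sqrtC (dot x x).

(* max_(0 <= i < k) a i for nonnegative reals a i and k > 0; the starting value
   0 is harmless, and over R[i] the a i are pairwise comparable. *)
Definition max_nneg (K : numDomainType) (k : nat) (a : nat -> K) : K :=
  \big[Num.max/0]_(0 <= i < k) a i.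

(* Main.v *)
Require Import Defs.
From HB Require Import structures.
From mathcomp Require Import all_boot all_order all_algebra.
From mathcomp Require Import reals.
From mathcomp.real_closed Require Import complex.

Set Implicit Arguments.
Unset Strict Implicit.
Unset Printing Implicit Defensive.

Import Order.TTheory GRing.Theory Num.Theory.

Local Open Scope ring_scope.

(* Removing from x_k its orthogonal projection onto the span of its predecessors
   leaves a residual v_k, and the Gram determinant is the product of the
   <v_k, v_k>. As v_k is the shortest vector of x_k + span(x_0, .., x_(k-1)), it
   is no longer than x_k - M^-1 sum_i <x_k, x_i> x_i for M the largest row sum
   of the moduli |<x_i, x_j>|; the Schur test (AM-GM on the cross terms) bounds
   the latter by the k-th factor. In particular the factors are nonnegative, so
   the bounds multiply.
   Both scalar fields are handled at once: all that matters is
   |a|^2 = a * theta a, with theta the identity over R, conjugation over R[i]. *)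

(** The order may be partial, so [Num.max] is an upper bound only of comparable elements. The
    induction therefore also carries nonnegativity of the running maximum. *)
Lemma max_nneg_ge (K : numDomainType) (k : nat) (a : nat -> K) :
  (forall i, 0 <= a i) -> forall i, (i < k)%N -> a i <= max_nneg k a.
Proof.
move=> a_ge0.
have: forall s, 0 <= \big[Num.max/0]_(i <- s) a i /\
    {in s, forall i, a i <= \big[Num.max/0]_(i <- s) a i}.
  elim=> [|j s [m_ge0 le_m]]; first by rewrite big_nil; split.
  rewrite big_cons; set m := \big[_/_]_(_ <- s) _ in m_ge0 le_m *.
  have cmp : (a j >=< m)%O by apply: real_comparable; exact: ger0_real.
  split=> [|i]; first by rewrite comparable_le_max // m_ge0 orbT.
  rewrite inE comparable_le_max // => /predU1P[->|/le_m->]; last exact: orbT.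
  by rewrite lexx.
by move=> /(_ (index_iota 0 k))[_ le_max] i ik; apply: le_max; rewrite mem_index_iota.
Qed.

Section InnerProduct.

Variables (K : numFieldType) (theta : {rmorphism K -> K}).
Hypothesis normE : forall a : K, `|a| ^+ 2 = a * theta a.
Variables (H : lmodType K) (dot : {dot H for theta}).
Implicit Types (u v w : H) (x : nat -> H).

Local Notation "''[' u , v ]" := (dot u%R v%R) : ring_scope.
Local Notation "''[' u ]" := '[u, u] : ring_scope.

(** Cancel [a] in [a * theta a = a ^+ 2]. *)
Lemma ge0_theta (a : K) : 0 <= a -> theta a = a.
Proof.
move=> a_ge0; have [->|a_neq0] := eqVneq a 0; first exact: rmorph0.
by apply: (mulfI a_neq0); rewrite -normE ger0_norm.
Qed.

Lemma norm_theta (a : K) : `|theta a| = `|a|.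
Proof.
have [->|a_neq0] := eqVneq a 0; first by rewrite rmorph0.
apply: (mulfI (_ : `|a| != 0)); first by rewrite normr_eq0.
by rewrite -normrM -normE ger0_norm ?exprn_ge0.
Qed.

(* The library states the next facts for bilinear and Hermitian forms; restating
   them fixes [dot] as head symbol, so that they can be chained by rewriting. *)
Lemma dotBl w : {morph dot^~ w : u v / u - v}.
Proof. exact: linearBl. Qed.

Lemma dotDr w : {morph dot w : u v / u + v}.
Proof. exact: linearDr. Qed.

Lemma dotZl a u v : '[a *: u, v] = a * '[u, v].
Proof. exact: linearZl_LR. Qed.

Lemma dotZr a u v : '[u, a *: v] = theta a * '[u, v].
Proof. exact: linearZr_LR. Qed.

Lemma dot_suml n (y : 'I_n -> H) v :
  '[\sum_i y i, v] = \sum_i '[y i, v].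
Proof. exact: linear_sumlz. Qed.

Lemma dot_sumr n (y : 'I_n -> H) v :
  '[v, \sum_i y i] = \sum_i '[v, y i].
Proof. exact: linear_sumr. Qed.

Lemma dot_normDd u v : '[u, v] = 0 -> '[u + v] = '[u] + '[v].
Proof. exact: hnormDd. Qed.

Lemma dot_normB u v : '[u - v] = '[u] + '[v] - ('[u, v] + theta '[u, v]).
Proof. by have /= := hnormB dot u v; rewrite mul1r. Qed.

Lemma dotC u v : '[u, v] = theta '[v, u].
Proof. by rewrite hermC expr0 mul1r. Qed.

Lemma norm_dotC u v : `|'[u, v]| = `|'[v, u]|.
Proof. by rewrite dotC norm_theta. Qed.

Lemma dot_ge0 u : 0 <= '[u].
Proof.
by have [->|/neq0_dnorm_gt0/ltW//] := eqVneq u 0; rewrite linear0r.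
Qed.

Lemma dot_sum_eq0 k (c : nat -> K) x v :
  (forall i, (i < k)%N -> '[v, x i] = 0) ->
  '[v, \sum_(i < k) c i *: x i] = 0.
Proof.
move=> ovx; rewrite dot_sumr big1 // => i _.
by rewrite dotZr /= ovx // mulr0.
Qed.

(** Gram-Schmidt by induction: project both [v] and [x k] off the first [k] vectors, then remove
    from the residual [v'] its component along the residual [x']. *)
Lemma orthogonal_projection k x v :
  exists c : nat -> K, forall i, (i < k)%N ->
    '[v - \sum_(j < k) c j *: x j, x i] = 0.
Proof.
elim: k => [|k IHk] in v *; first by exists (fun=> 0).
have [c oc] := IHk v; have [d od] := IHk (x k).
set v' := v - _ in oc; set x' := x k - _ in od.
pose t := '[v', x'] / '[x'].
exists (fun j => if (j < k)%N then c j - t * d j else t).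
have -> : v - \sum_(j < k.+1)
    (if (j < k)%N then c j - t * d j else t) *: x j = v' - t *: x'.
  rewrite big_ord_recr /= ltnn.
  under eq_bigr => j _ do rewrite ltn_ord scalerBl -scalerA.
  rewrite sumrB -scaler_sumr /v' /x' scalerBr !opprD !opprK !addrA.
  by rewrite (addrAC (_ - _)).
have ortho i : (i < k)%N -> '[v' - t *: x', x i] = 0.
  by move=> ik; rewrite dotBl dotZl /= oc // od // mulr0 subrr.
move=> i; rewrite ltnS leq_eqVlt => /predU1P[->|/ortho//].
(* As [x k] is [x'] plus a combination of its predecessors, only the product with [x'] remains. *)
rewrite -[x k](subrK (\sum_(j < k) d j *: x j)) -/x' dotDr.
rewrite dot_sum_eq0 // addr0 dotBl dotZl /= /t.
have [->|x'_neq0] := eqVneq x' 0; first by rewrite !linear0r mulr0 subrr.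
by rewrite divfK ?subrr // gt_eqF // neq0_dnorm_gt0.
Qed.

(** With [x] a sequence rather than a tuple, all leading blocks are instances of one definition,
    which suits induction on the size. *)
Definition gram_mx k x := \matrix_(i < k, j < k) '[x i, x j].

(* A row operation replaces the last row of the Gram matrix by the products
   with [v], of which only the last one is nonzero. *)
Lemma det_gram_mxS k x (c : nat -> K) :
  let v := x k - \sum_(j < k) c j *: x j in
  (forall i, (i < k)%N -> '[v, x i] = 0) ->
  \det (gram_mx k.+1 x) = \det (gram_mx k x) * '[v].
Proof.
move=> v ov.
(* Lower triangular with unit diagonal; its last row holds the coefficients of [v] in the [x i]. *)
pose A : 'M[K]_k.+1 := \matrix_(i, j)
  if j == i then 1 else if i == ord_max then - c j else 0.
have detA : \det A = 1.
  rewrite det_trig; first by rewrite big1 // => i _; rewrite mxE eqxx.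
  apply/is_trig_mxP => i j ij; rewrite mxE -val_eqE /= gtn_eqF //.
  by case: eqP => // i_max; move: ij; rewrite i_max ltnNge leq_ord.
have AG i j : (A *m gram_mx k.+1 x) i j =
    if i == ord_max then '[v, x j] else '[x i, x j].
  rewrite mxE; under eq_bigr => l _ do rewrite !mxE.
  case: ifP => [/eqP->|i_max].
    rewrite big_ord_recr /= eqxx mul1r addrC /v dotBl dot_suml -sumrN.
    congr (_ + _); apply: eq_bigr => l _; rewrite dotZl /=.
    by rewrite -val_eqE /= ltn_eqF // mulNr.
  rewrite (bigD1 i) //= eqxx mul1r big1 ?addr0 // => l /negPf->.
  by rewrite mul0r.
rewrite -[LHS]mul1r -detA -det_mulmx (expand_det_row _ ord_max).
rewrite (bigD1 ord_max) //= big1 => [|j j_max]; last first.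
  rewrite AG eqxx ov ?mul0r // ltn_neqAle -ltnS ltn_ord andbT.
  by apply: contraNneq j_max => jk; apply/eqP/val_inj.
rewrite addr0 AG eqxx /cofactor -signr_odd addnn odd_double mul1r mulrC /=.
congr (\det _ * _).
  apply/matrixP => i j; do 2!rewrite [LHS]mxE; rewrite AG [RHS]mxE.
  by rewrite !lift_max -val_eqE [val _]lift_max ltn_eqF /=.
rewrite -[in LHS](subrK (\sum_(j < k) c j *: x j) (x k)) dotDr -/v.
by rewrite dot_sum_eq0 ?addr0.
Qed.

(** Pythagoras: the two vectors differ by a combination of the [x j], which is orthogonal to [v]. *)
Lemma dot_projection_le k (b c : nat -> K) x u :
  let v := u - \sum_(j < k) c j *: x j in
  (forall i, (i < k)%N -> '[v, x i] = 0) ->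
  '[v] <= '[u - \sum_(j < k) b j *: x j].
Proof.
move=> v ov; set w := u - \sum_(j < k) b j *: x j.
have -> : w = v + \sum_(j < k) (c j - b j) *: x j.
  under eq_bigr do rewrite scalerBl.
  by rewrite sumrB /v addrA subrK.
by rewrite dot_normDd; [rewrite lerDl dot_ge0|exact: (dot_sum_eq0 (fun j => c j - b j) ov)].
Qed.

Lemma dot_sum_le k (c : nat -> K) x (M : K) :
  (forall i, (i < k)%N -> \sum_(j < k) `|'[x i, x j]| <= M) ->
  '[\sum_(i < k) c i *: x i] <= M * \sum_(i < k) `|c i| ^+ 2.
Proof.
move=> rowM; set u := \sum_(i < k) _.
(* The modulus gives access to the triangle inequality; doubling prepares
   [2 |c i| |c j| <= |c i|^2 + |c j|^2]. By symmetry of [G] the two squares contribute equally, each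
   through row sums of [G]. *)
rewrite -(ger0_norm (dot_ge0 u)) -(ler_pMn2r (ltn0Sn 1)).
pose G (i j : 'I_k) : K := `|'[x i, x j]|.
have le_u : `|'[u]| <= \sum_(i < k) \sum_(j < k) `|c i| * `|c j| * G i j.
  rewrite {1}/u dot_suml (le_trans (ler_norm_sum _ _ _)) //.
  apply: ler_sum => i _; rewrite dotZl dot_sumr mulr_sumr.
  rewrite (le_trans (ler_norm_sum _ _ _)) //; apply: ler_sum => j _.
  by rewrite dotZr !normrM norm_theta mulrA.
rewrite -(ler_pMn2r (ltn0Sn 1)) in le_u; apply: (le_trans le_u).
have -> : M * \sum_(i < k) `|c i| ^+ 2 = \sum_(i < k) `|c i| ^+ 2 * M.
  by rewrite mulrC mulr_suml.
suff le_sum : (\sum_(i < k) \sum_(j < k) `|c i| * `|c j| * G i j) *+ 2 <=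
    \sum_(i < k) \sum_(j < k) (`|c i| ^+ 2 + `|c j| ^+ 2) * G i j.
  apply: (le_trans le_sum).
  have -> : \sum_(i < k) \sum_(j < k) (`|c i| ^+ 2 + `|c j| ^+ 2) * G i j =
            (\sum_(i < k) `|c i| ^+ 2 * \sum_(j < k) G i j) *+ 2.
    under eq_bigr => i _ do under eq_bigr => j _ do rewrite mulrDl.
    under eq_bigr => i _ do rewrite big_split.
    rewrite big_split mulr2n /=; congr (_ + _).
      by apply: eq_bigr => i _; rewrite mulr_sumr.
    rewrite exchange_big; apply: eq_bigr => i _ /=; rewrite mulr_sumr.
    by apply: eq_bigr => j _; rewrite /G norm_dotC.
  rewrite lerMn2r /=; apply: ler_sum => i _.
  by rewrite ler_wpM2l ?exprn_ge0 // rowM.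
rewrite -sumrMnl; apply: ler_sum => i _; rewrite -sumrMnl.
apply: ler_sum => j _; rewrite -mulrnAl ler_wpM2r ?normr_ge0 //.
by rewrite real_leif_mean_square_scaled ?normr_real.
Qed.

Lemma dot_residual_le k (c : nat -> K) x u (M : K) :
  let v := u - \sum_(j < k) c j *: x j in
  (forall i, (i < k)%N -> '[v, x i] = 0) ->
  (forall i, (i < k)%N -> \sum_(j < k) `|'[x i, x j]| <= M) -> 0 <= M ->
  '[v] <= '[u] - (\sum_(i < k) `|'[u, x i]| ^+ 2) / M.
Proof.
move=> v ov rowM M_ge0; set S := \sum_(i < k) `|'[u, x i]| ^+ 2.
(* For coefficients [t * '[u, x i]] with [t] real, the squared length is at most ['[u] - 2 t S + t^2
   M S]; for [M > 0] this is least at [t = M^-1]. *)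
pose b i := M^-1 * '[u, x i].
apply: (le_trans (dot_projection_le b ov)).
set w := \sum_(j < k) b j *: x j.
have SM_ge0 : 0 <= S / M.
  by rewrite mulr_ge0 ?invr_ge0 // sumr_ge0 // => i _; rewrite exprn_ge0.
have uw : '[u, w] = S / M.
  rewrite dot_sumr mulrC mulr_sumr; apply: eq_bigr => i _.
  rewrite dotZr /= rmorphM ge0_theta ?invr_ge0 // -mulrA normE.
  by rewrite (mulrC (theta _)).
have w_le : '[w] <= S / M.
  apply: (le_trans (dot_sum_le b rowM)).
  under eq_bigr do rewrite normrM ger0_norm ?invr_ge0 // exprMn.
  rewrite -mulr_sumr -/S.
  (* [M = 0] does occur, for instance at [k = 0]; as [0^-1 = 0], both sides then vanish. *)
  have [->|M_neq0] := eqVneq M 0; first by rewrite mul0r invr0 mulr0.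
  by rewrite expr2 !mulrA divff // mul1r mulrC.
by rewrite dot_normB uw ge0_theta // -!addrA lerD2l opprD addrA gerDr subr_le0.
Qed.

Lemma det_gram_mx_bounds n x :
  let factor k := '[x k] - (\sum_(0 <= i < k) `|'[x k, x i]| ^+ 2) /
    max_nneg k (fun i => \sum_(0 <= j < k) `|'[x i, x j]|) in
  \det (gram_mx n x) <= \prod_(0 <= k < n) factor k /\
  \prod_(0 <= k < n) factor k <= \prod_(0 <= k < n) '[x k].
Proof.
move=> factor; have row_ge0 k i : 0 <= \sum_(0 <= j < k) `|'[x i, x j]|.
  by apply: sumr_ge0.
have max_ge0 k : 0 <= max_nneg k (fun i => \sum_(0 <= j < k) `|'[x i, x j]|).
  case: k => [|k]; first by rewrite /max_nneg big_nil.
  by apply: le_trans (row_ge0 k.+1 0%N) _; exact: max_nneg_ge.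
have step k : exists2 d, 0 <= d <= factor k &
    \det (gram_mx k.+1 x) = \det (gram_mx k x) * d.
  have [c oc] := orthogonal_projection k x (x k).
  exists '[x k - \sum_(j < k) c j *: x j]; last exact: det_gram_mxS.
  rewrite dot_ge0 /factor big_mkord; apply: dot_residual_le => // i ik.
  by rewrite -(big_mkord xpredT (fun j => `|'[x i, x j]|)); exact: max_nneg_ge.
have factor_ge0 k : 0 <= factor k.
  by have [d /andP[d_ge0 le_d] _] := step k; exact: le_trans le_d.
split; last first.
  apply: ler_prod => k _; rewrite factor_ge0 gerBl divr_ge0 // sumr_ge0 // => i _.
  by rewrite exprn_ge0.
(* Nonnegativity of the determinant joins the induction so that the inequalities can be
   multiplied. *)
suff /andP[] : 0 <= \det (gram_mx n x) <= \prod_(0 <= k < n) factor k by [].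
elim: n => [|n /andP[det_ge0 le_det]]; first by rewrite det_mx00 big_nil ler01 lexx.
have [d /andP[d_ge0 le_d] ->] := step n.
by rewrite big_nat_recr //= mulr_ge0 // ler_pM.
Qed.

(** Only the square of [norm] is prescribed, so that both [Num.sqrt] and [sqrtC] fit. *)
Lemma gram_bounds (norm : H -> K) n (x : n.-tuple H) :
  (forall v, norm v ^+ 2 = '[v]) -> (0 < n)%N ->
  let middle := norm x`_0 ^+ 2 *
    \prod_(1 <= k < n) (norm x`_k ^+ 2 -
      (\sum_(0 <= i < k) `|'[x`_k, x`_i]| ^+ 2) /
      max_nneg k (fun i => \sum_(0 <= j < k) `|'[x`_i, x`_j]|)) in
  gram dot x <= middle /\ middle <= \prod_(0 <= j < n) norm x`_j ^+ 2.
Proof.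
move=> sqr_norm n_gt0 middle.
have [] := det_gram_mx_bounds n (nth 0 x).
rewrite big_ltn //.
(* The factor of index 0 has an empty numerator and reduces to the squared norm of the first
   vector. *)
rewrite big_nil mul0r subr0 -/(gram dot x) /middle => le_gram le_prod.
have -> : \prod_(0 <= j < n) norm x`_j ^+ 2 = \prod_(0 <= j < n) '[x`_j].
  by apply: eq_bigr.
by rewrite sqr_norm; under eq_bigr do rewrite sqr_norm.
Qed.

End InnerProduct.

Theorem mainTheorem9 (R : realType) :
  (forall (H : lmodType R) (dot : {dot H for (@idfun R)})
          (n : nat) (x : n.-tuple H),
     (2 <= n)%N -> lin_indep x ->
     let norm := norm_real dot in
     let middle :=
       norm x`_0 ^+ 2 *
       \prod_(1 <= k < n)
         (norm x`_k ^+ 2 -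
          (\sum_(0 <= i < k) `|dot x`_k x`_i| ^+ 2) /
          max_nneg k (fun i => \sum_(0 <= j < k) `|dot x`_i x`_j|)) in
     gram dot x <= middle /\ middle <= \prod_(0 <= j < n) norm x`_j ^+ 2)
  /\
  (forall (H : lmodType R[i]) (dot : {dot H for (@Num.conj R[i])})
          (n : nat) (x : n.-tuple H),
     (2 <= n)%N -> lin_indep x ->
     let norm := norm_complex dot in
     let middle :=
       norm x`_0 ^+ 2 *
       \prod_(1 <= k < n)
         (norm x`_k ^+ 2 -
          (\sum_(0 <= i < k) `|dot x`_k x`_i| ^+ 2) /
          max_nneg k (fun i => \sum_(0 <= j < k) `|dot x`_i x`_j|)) in
     gram dot x <= middle /\ middle <= \prod_(0 <= j < n) norm x`_j ^+ 2).
Proof.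
split=> H dot n x /ltnW n_gt0 _ norm.
  have normE (a : R) : `|a| ^+ 2 = a * idfun a.
    by rewrite real_normK ?num_real // expr2.
  apply: (gram_bounds normE) => // v.
  exact/sqr_sqrtr/(dot_ge0 dot).
apply: (gram_bounds (@normCK _)) => // v.
exact: sqrtCK.
Qed.
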